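(* Let $(X_t)_{0\le t<\tau_\partial}$ satisfy Assumption (E), with $a$, $(\tilde P_t)$ and $\tilde\pi$ as there, and set $\lambda:=a\,\tilde\pi\tilde P_1 1>0$. Then there exists a bounded Borel function $h:\chi\to(0,\infty)$ (everywhere strictly positive) such that $P_th(x)=\lambda^th(x)$ for all $x\in\chi$ and $t\ge0$. If in addition $V\subseteq\chi$ is open and, for every $t\ge0$, $P_t$ maps bounded non-negative lower semicontinuous functions that are continuous on $V$ to bounded non-negative lower semicontinuous functions that are continuous on $V$, then $h$ may be taken continuous on $V$.
   Context: $\chi$ is a metric space with Borel $\sigma$-algebra and a distinguished $\sigma$-finite Borel measure $\Lambda$ of full support. $(X_t)_{0\le t<\tau_\partial}$ is a killed Markov process on $\chi$ with absorption time $\tau_\partial$ and submarkovian semigroup $P_t(x,A)=\mathbb P_x(X_t\in A,\tau_\partial>t)$; $K1(x)=K(x,\chi)$; for a measure $\mu$, $\mu K=\int\mu(dx)K(x,\cdot)$. A QSD of a submarkovian semigroup $(\tilde P_t)$ is a probability $\tilde\pi$ with $\tilde\pi\tilde P_t=(\tilde\pi\tilde P_t1)\tilde\pi$ for all $t$. A submarkovian kernel (semigroup) is lower semicontinuous if it maps bounded continuous non-negative functions to lower semicontinuous functions. $C_{b,\gg}(\chi)$ = bounded continuous functions with positive infimum; $\mathcal P_\infty(\Lambda)$ = probability measures $\ll\Lambda$ with density in $L^\infty(\Lambda)$. Assumption (E): $\chi$ is separable; $\mathbb P_x(\tau_\partial>t)>0$ for all $x\in\chi$, $t<\infty$; there exist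 $c_0>0$, $t_0>0$, $\nu\in\mathcal P(\chi)$ with $\mathbb P_x(X_{t_0}\in\cdot\mid\tau_\partial>t_0)\ge c_0\nu$ for all $x$; $(P_t)$ is lower semicontinuous; there exist $\psi\in C_{b,\gg}(\chi)$, $a>0$ and a submarkovian semigroup $(\tilde P_t)$ with $\psi(x)\Lambda(dx)P_t(x,dy)=a^t\psi(y)\Lambda(dy)\tilde P_t(y,dx)$ for all $t\ge0$; $(\tilde P_t)$ has a QSD $\tilde\pi\in\mathcal P_\infty(\Lambda)$; and there exist an open $\mathcal O\subseteq\chi$, $c_1>0$, $t_1>0$ with $\tilde\pi\ge c_1\Lambda|_{\mathcal O}$ and $\mathbb P_\nu(X_{t_1}\in\mathcal O)>0$. *)

(* Defs.v *)
From HB Require Import structures.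
From mathcomp Require Import all_boot all_order all_algebra.
From mathcomp Require Import all_classical all_reals all_analysis.
Set Implicit Arguments. Unset Strict Implicit. Unset Printing Implicit Defensive.
Import Order.TTheory GRing.Theory Num.Theory.
Import numFieldNormedType.Exports.
Local Open Scope classical_set_scope.
Local Open Scope ring_scope.

(* A metric space carrying (on the same carrier) a sigma-algebra; the
   statement additionally assumes that this sigma-algebra is the Borel one. *)
#[short(type="metricMeasurableType")]
HB.structure Definition MetricMeasurable (R : numDomainType) (d : measure_display) :=
  { T of Metric R T & Measurable d T }.

Section defs.
Context {R : realType} {d : measure_display} (T : metricMeasurableType R d).

Definition borel_sigma : Prop :=
  (measurable : set (set T)) = <<s (@open T) >>.

Definition separable : Prop :=
  exists D : set T, countable D /\ closure D = setT.


Definition lsc (f : T -> R) : Prop := lower_semicontinuous (fun x => (f x)%:E).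

Definition kact (K : T -> {measure set T -> \bar R}) (f : T -> R) (x : T) : \bar R :=
  (\int[K x]_y (f y)%:E)%E.

Definition kactR (K : T -> {measure set T -> \bar R}) (f : T -> R) (x : T) : R :=
  fine (kact K f x).

Definition condK (K : T -> {measure set T -> \bar R}) (x : T) (A : set T) : \bar R :=
  (K x A * ((fine (K x setT))^-1)%:E)%E.

Definition submarkov_semigroup (P : R -> R.-spker T ~> T) : Prop :=
  (forall x A, measurable A -> P 0 x A = \d_x A) /\
  (forall s t x A, 0 <= s -> 0 <= t -> measurable A ->
     P (s + t) x A = (\int[P s x]_y P t y A)%E).

Definition lsc_kernel (K : T -> {measure set T -> \bar R}) : Prop :=
  forall f : T -> R, bounded_fun f -> continuous f -> (forall x, 0 <= f x) ->
    lower_semicontinuous (kact K f).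

Definition bnn_lsc_contV (V : set T) (f : T -> R) : Prop :=
  [/\ bounded_fun f, (forall x, 0 <= f x), lsc f &
      (forall x, V x -> {for x, continuous f})].

End defs.

(* Main.v *)
Require Import Defs.
From HB Require Import structures.
From mathcomp Require Import all_boot all_order all_algebra.
From mathcomp Require Import all_classical all_reals all_analysis.
From mathcomp Require Import measurable_realfun ring lra.
Import Order.TTheory GRing.Theory Num.Theory.
Import numFieldNormedType.Exports.
Local Open Scope classical_set_scope.
Local Open Scope ring_scope.
Set Implicit Arguments. Unset Strict Implicit. Unset Printing Implicit Defensive.

(** Duality with respect to [psi * Lam] turns the quasi-stationarity of [pit]
    into [P_t 1_O <= const * lam^t], first almost everywhere and then, by lower
    semicontinuity and full support, everywhere.  Since the minorization gives
    [P_(t+t1) 1_O >= const * P_t 1] for [t >= t0], the functions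
    [E_t = lam^-t P_t 1] are uniformly bounded; the reverse duality bound on [O]
    and [nu P_t1 << Lam] give a uniform lower bound for [nu E_t].

    With these two bounds the minorization makes [lam^-t0 P_t0] a contraction
    for the oscillation of ratios: if [al E_t <= lam^-s P_s E_t <= be E_t], the
    same holds at time [t + t0] with [be - al] shrunk by a fixed factor.  As
    [al <= 1 <= be] throughout, [E_(n t0)] converges uniformly and geometrically
    fast to a positive [h] with [P_s h = lam^s h] for all [s], and uniform
    convergence transfers continuity on [V] from [P_t 1] to [h]. *)

(** * Integrals of mixtures and of bounded non-negative functions *)

Section integration.
Import HBNNSimple.
Context {R : realType} {d : measure_display} {T : measurableType d}.
Implicit Types (mu nu : {measure set T -> \bar R}) (K : R.-ker T ~> T).
Implicit Types (f g : T -> R).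

(** By linearity the hypothesis on sets settles simple functions. Monotone convergence along
    [nnsfun_approx], in the inner and then in the outer integral, settles the rest. *)
Lemma ge0_integral_mixture mu nu K (f : T -> \bar R) :
  (forall A, measurable A -> nu A = (\int[mu]_y K y A)%E) ->
  (forall x, 0 <= f x)%E -> measurable_fun setT f ->
  (\int[nu]_x f x = \int[mu]_y \int[K y]_x f x)%E.
Proof.
move=> nuE f0 mf.
pose g := nnsfun_approx measurableT mf.
have mg n : measurable_fun setT (EFin \o g n) by exact/measurable_EFinP.
have g0 n x : (0 <= (EFin \o g n) x)%E by rewrite lee_fin.
have ndg x : {homo (fun n => (EFin \o g n) x) : n m / (n <= m)%N >-> (n <= m)%E}.
  by move=> n m nm; exact/lefP/nd_nnsfun_approx.
have fE x : f x = limn (fun n => (EFin \o g n) x).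
  by apply/esym/cvg_lim => //; exact: cvg_nnsfun_approx.
have mK := measurable_kernel K.
transitivity (limn (fun n => \int[nu]_x (EFin \o g n) x))%E.
  by rewrite -monotone_convergence//; apply: eq_integral => x _; exact: fE.
transitivity (limn (fun n => \int[mu]_y \int[K y]_x (EFin \o g n) x))%E; last first.
  rewrite -monotone_convergence//.
  - apply: eq_integral => y _; rewrite -monotone_convergence//.
    by apply: eq_integral => x _; exact/esym/fE.
  - by move=> n; exact: measurable_fun_integral_kernel.
  - by move=> n y _; exact: integral_ge0.
  - by move=> y _ n m nm; apply: ge0_le_integral => // x _; exact: ndg.
apply: congr_lim; apply/funext => n.
under [RHS]eq_integral do rewrite integralT_nnsfun sintegralE.
rewrite integralT_nnsfun sintegralE ge0_integral_fsum//.
- apply: eq_fsbigr => r; rewrite inE => -[t _ <-]; rewrite ge0_integralZl//.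
  + by rewrite nuE//; exact: measurable_funPTI.
  + exact: mK.
  + by rewrite lee_fin.
- by move=> r; apply: measurable_funeM; exact: mK.
- by move=> r y _; exact: nnsfun_mulemu_ge0.
Qed.

(** This class is stable under submarkovian kernels. Against a finite measure its members have
    finite integrals, so the real-valued integral is the true one and not a default value of
    [fine]. *)
Definition bmn f := measurable_fun [set: T] f /\ exists M, forall x, 0 <= f x <= M.

Lemma bmn_bounded f : bmn f -> bounded_fun f.
Proof.
move=> [_ [M fM]]; exists M; split; first exact: num_real.
move=> N MN x _ /=; have /andP[f0 fx] := fM x.
by rewrite ger0_norm// (le_trans fx)// ltW.
Qed.

Lemma bmn_cst (r : R) : 0 <= r -> bmn (cst r).
Proof. by move=> r0; split => //; exists r => x; rewrite r0 lexx. Qed.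

Lemma bmnD f g : bmn f -> bmn g -> bmn (f \+ g).
Proof.
move=> [mf [M fM]] [mg [N gN]]; split; first exact: measurable_funD.
exists (M + N) => x; have /andP[? ?] := fM x; have /andP[? ?] := gN x.
by rewrite addr_ge0//= lerD.
Qed.

Lemma bmnZ (r : R) f : 0 <= r -> bmn f -> bmn (fun x => r * f x).
Proof.
move=> r0 [mf [M fM]]; split; first exact: measurable_funM.
by exists (r * M) => x; have /andP[? ?] := fM x; rewrite mulr_ge0//= ler_wpM2l.
Qed.

Lemma bmnB f g : bmn f -> bmn g -> (forall x, g x <= f x) -> bmn (f \- g).
Proof.
move=> [mf [M fM]] [mg [N gN]] gf; split; first exact: measurable_funB.
exists M => x; have /andP[? ?] := fM x; have /andP[? ?] := gN x.
by rewrite subr_ge0 gf/= lerBlDr (le_trans (y := M)) ?lerDl.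
Qed.

Section finite.
Variable mu : {measure set T -> \bar R}.
Hypothesis mufin : (mu setT < +oo)%E.

Lemma bmn_integrable f : bmn f -> mu.-integrable setT (EFin \o f).
Proof.
move=> fb; apply: measurable_bounded_integrable => //; first exact: fb.1.
exact: bmn_bounded.
Qed.

Lemma bmn_EFin f : bmn f -> (\int[mu]_x (f x)%:E)%E = (\int[mu]_x f x)%:E.
Proof.
by move=> fb; rewrite fineK//; apply: integrable_fin_num => //; exact: bmn_integrable.
Qed.

Lemma bmn_int_le f g : bmn f -> bmn g -> (forall x, f x <= g x) ->
  \int[mu]_x f x <= \int[mu]_x g x.
Proof. by move=> fb gb fg; apply: le_Rintegral => //; exact: bmn_integrable. Qed.

Lemma bmn_int_ge0 f : bmn f -> 0 <= \int[mu]_x f x.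
Proof.
by move=> [_ [M fM]]; apply: Rintegral_ge0 => x _; have /andP[] := fM x.
Qed.

Lemma bmn_intZ (r : R) f : bmn f -> \int[mu]_x (r * f x) = r * \int[mu]_x f x.
Proof. by move=> fb; rewrite RintegralZl//; exact: bmn_integrable. Qed.

Lemma bmn_intD f g : bmn f -> bmn g ->
  \int[mu]_x (f x + g x) = \int[mu]_x f x + \int[mu]_x g x.
Proof. by move=> fb gb; rewrite RintegralD//; exact: bmn_integrable. Qed.

Lemma bmn_intB f g : bmn f -> bmn g ->
  \int[mu]_x (f x - g x) = \int[mu]_x f x - \int[mu]_x g x.
Proof. by move=> fb gb; rewrite RintegralB//; exact: bmn_integrable. Qed.

Lemma bmn_int_ub f (M : R) : bmn f -> 0 <= M -> (forall x, f x <= M) ->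
  \int[mu]_x f x <= M * fine (mu setT).
Proof.
move=> fb M0 fM; rewrite -Rintegral_cst//; apply: bmn_int_le => //.
exact: bmn_cst.
Qed.

End finite.

End integration.

(** * Submarkovian kernels as operators on bounded functions *)

Section kernel_action.
Context {R : realType} {d : measure_display} {T : measurableType d}.
Implicit Types (K : R.-spker T ~> T) (f g : T -> R).

Definition kint K f : T -> R := fun x => \int[K x]_y f y.

Lemma spker_fin K x : (K x setT < +oo)%E.
Proof. exact: le_lt_trans (sprob_kernel_le1 K x) (ltry _). Qed.

Lemma kint_EFin K f x : bmn f -> (\int[K x]_y (f y)%:E)%E = (kint K f x)%:E.
Proof. by move=> fb; rewrite bmn_EFin//; exact: spker_fin. Qed.

Lemma kint_ub K f (M : R) x : bmn f -> 0 <= M -> (forall y, f y <= M) ->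
  kint K f x <= M.
Proof.
move=> fb M0 fM; rewrite (le_trans (bmn_int_ub _ fb M0 fM))//; first exact: spker_fin.
rewrite -[leRHS]mulr1 ler_wpM2l// -lee_fin fineK ?sprob_kernel_le1//.
by rewrite ge0_fin_numE//; exact: spker_fin.
Qed.

Lemma bmn_kint K f : bmn f -> bmn (kint K f).
Proof.
move=> fb; have [mf [M fM]] := fb; split.
  apply: (measurableT_comp (fine_measurable measurableT)).
  apply: measurable_fun_integral_kernel; first exact: measurable_kernel.
    by move=> z; rewrite lee_fin; have /andP[] := fM z.
  exact/measurable_EFinP.
exists M => x; rewrite bmn_int_ge0//= kint_ub//.
  by have /andP[f0 fx] := fM x; exact: le_trans fx.
by move=> y; have /andP[] := fM y.
Qed.

Lemma kint_comp K1 K2 K3 f x :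
  (forall A, measurable A -> K3 x A = (\int[K1 x]_y K2 y A)%E) ->
  bmn f -> kint K3 f x = kint K1 (kint K2 f) x.
Proof.
move=> K3E fb; apply/EFin_inj; rewrite -!kint_EFin//; last exact: bmn_kint.
rewrite (ge0_integral_mixture (mu := K1 x) (K := K2))//.
- by apply: eq_integral => y _; rewrite kint_EFin.
- by move=> y; rewrite lee_fin; case: fb => _ [M /(_ y)/andP[]].
- by apply/measurable_EFinP; case: fb.
Qed.

Lemma kint_le K f g x : bmn f -> bmn g -> (forall y, f y <= g y) ->
  kint K f x <= kint K g x.
Proof. by move=> fb gb fg; apply: bmn_int_le => //; exact: spker_fin. Qed.

Lemma kintZ K (r : R) f x : bmn f -> kint K (fun y => r * f y) x = r * kint K f x.
Proof. by move=> fb; apply: bmn_intZ => //; exact: spker_fin. Qed.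

Lemma kintD K f g x : bmn f -> bmn g ->
  kint K (fun y => f y + g y) x = kint K f x + kint K g x.
Proof. by move=> fb gb; apply: bmn_intD => //; exact: spker_fin. Qed.

Lemma kintB K f g x : bmn f -> bmn g ->
  kint K (fun y => f y - g y) x = kint K f x - kint K g x.
Proof. by move=> fb gb; apply: bmn_intB => //; exact: spker_fin. Qed.

End kernel_action.

(** * Nonemptiness, and limits of geometrically controlled sequences *)

Lemma probability_inhabited {R : realType} {d : measure_display}
    {T : measurableType d} (mu : probability T R) : exists x : T, True.
Proof.
apply: contrapT => noT; have := probability_setT mu.
rewrite (_ : setT = set0) ?measure0; last first.
  by apply/seteqP; split => // x _; apply: noT; exists x.
by move=> /eqP; rewrite eq_sym onee_eq0.
Qed.

Lemma le_geometric0 {R : realType} (a K q : R) : 0 <= q < 1 ->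
  (forall n, a <= K * q ^+ n) -> a <= 0.
Proof.
move=> /andP[q0 q1] aK.
have : (fun n => K * q ^+ n) n @[n --> \oo] --> K * 0.
  by apply: cvgMl_tmp; apply: cvg_expr; rewrite ger0_norm.
by rewrite mulr0 => /cvgr_to_ge; apply; exact: nearW.
Qed.

(** The tail bound sums a geometric series: [D q^n + D/(1-q) q^(n+1) = D/(1-q) q^n]. It depends only
    on [D] and [q], so using the lemma at every point of a space with common constants gives uniform
    convergence. *)
Lemma geometric_cvg {R : realType} (u : nat -> R) (D q : R) : 0 <= q < 1 ->
  (forall n, `|u n.+1 - u n| <= D * q ^+ n) ->
  u n @[n --> \oo] --> limn u /\
  forall n, `|limn u - u n| <= D / (1 - q) * q ^+ n.
Proof.
move=> /andP[q0 q1] uD; have q1' : 0 < 1 - q by rewrite subr_gt0.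
have tail k n : `|u (k + n)%N - u n| <= D / (1 - q) * q ^+ n.
  elim: k n => [|k IH] n.
    rewrite add0n subrr normr0 mulr_ge0 ?exprn_ge0// divr_ge0 ?(ltW q1')//.
    by have := uD 0; rewrite expr0 mulr1; exact: le_trans.
  rewrite -(subrK (u n.+1) (u _)) addSnnS -addrA (le_trans (ler_normD _ _))//.
  have -> : D / (1 - q) * q ^+ n = D / (1 - q) * q ^+ n.+1 + D * q ^+ n.
    by rewrite exprS; field; rewrite gt_eqF.
  exact: lerD.
(* The correction adds [D * q ^+ n] to each increment of [u], which makes [v] nondecreasing; [u]
   then differs from a bounded monotone sequence by a null sequence. *)
pose v n := u n - D / (1 - q) * q ^+ n.
have vE n : v n.+1 - v n = (u n.+1 - u n) + D * q ^+ n.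
  by rewrite /v exprS; field; rewrite gt_eqF.
have v_nd : nondecreasing_seq v.
  apply/nondecreasing_seqP => n; rewrite -subr_ge0 vE.
  by have := uD n; rewrite ler_norml => /andP[+ _]; rewrite -subr_ge0 opprK.
have D1 : 0 <= D / (1 - q) by have := tail 0 0; rewrite subrr normr0 mulr1.
have v_ub : has_ubound (range v).
  exists (u 0 + D / (1 - q)) => _ [n _ <-]; rewrite /v.
  have := tail n 0; rewrite addn0 expr0 mulr1 ler_norml lerBlDl => /andP[_ un].
  by rewrite lerBlDr (le_trans un)// lerDl mulr_ge0 ?exprn_ge0.
have cv := nondecreasing_is_cvgn v_nd v_ub.
have cq : (fun n => D / (1 - q) * q ^+ n) n @[n --> \oo] --> D / (1 - q) * 0.
  by apply: cvgMl_tmp; apply: cvg_expr; rewrite ger0_norm.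
have cu : cvgn u.
  have -> : u = v \+ (fun n => D / (1 - q) * q ^+ n).
    by apply/funext => n; rewrite /v /= subrK.
  by apply: is_cvgD => //; apply/cvg_ex; eexists; exact: cq.
split => // n.
have cn : (fun k => `|u (k + n)%N - u n|) k @[k --> \oo] --> `|limn u - u n|.
  by apply: cvg_norm; apply: cvgB; [rewrite (cvg_shiftn n u)|exact: cvg_cst].
by apply: (cvgr_to_le cn); exact: nearW.
Qed.

(** * Contraction of ratios and construction of the eigenfunction *)

Section eigenfunction.
Context {R : realType} {d : measure_display} {T : measurableType d}.
Variables (P : R -> R.-spker T ~> T) (nu : probability T R) (lam t0 c0 C m : R).
Hypothesis Pcomp : forall s t f x, 0 <= s -> 0 <= t -> bmn f ->
  kint (P (s + t)) f x = kint (P s) (kint (P t) f) x.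
Hypothesis lam_gt0 : 0 < lam.
Hypothesis t0_gt0 : 0 < t0.
Hypothesis c0_gt0 : 0 < c0.
Hypothesis doeblin : forall f x, bmn f ->
  c0 * kint (P t0) (cst 1) x * \int[nu]_y f y <= kint (P t0) f x.

(** For the rescaled semigroup the eigenfunction equation becomes invariance, [S t h = h]. *)
Let S t f x := (lam `^ t)^-1 * kint (P t) f x.
Let E t := S t (cst 1).
Hypothesis E_gt0 : forall t x, 0 <= t -> 0 < E t x.
Hypothesis E_le : forall t x, 0 <= t -> E t x <= C.
Hypothesis C_gt0 : 0 < C.
Hypothesis m_gt0 : 0 < m.
Hypothesis E_nu : forall t, 0 <= t -> m <= \int[nu]_y E t y.

Let lamV_ge0 t : 0 <= (lam `^ t)^-1.
Proof. by rewrite invr_ge0 powR_ge0. Qed.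

Let bmnS t f : bmn f -> bmn (S t f).
Proof. by move=> fb; apply: bmnZ; [exact: lamV_ge0|exact: bmn_kint]. Qed.

Let bmnE t : bmn (E t).
Proof. by apply: bmnS; exact: bmn_cst. Qed.

Let Scomp s t f x : 0 <= s -> 0 <= t -> bmn f -> S (s + t) f x = S s (S t f) x.
Proof.
move=> s0 t0' fb; rewrite /S Pcomp// kintZ; last exact: bmn_kint.
by rewrite powRD ?(gt_eqF lam_gt0) ?implybT// invfM mulrA.
Qed.

Let Sle t f g x : bmn f -> bmn g -> (forall y, f y <= g y) -> S t f x <= S t g x.
Proof. by move=> fb gb fg; rewrite ler_wpM2l//; exact: kint_le. Qed.

Let SZ t (r : R) f x : bmn f -> S t (fun y => r * f y) x = r * S t f x.
Proof. by move=> fb; rewrite /S kintZ// mulrCA. Qed.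

Let SB t f g x : bmn f -> bmn g ->
  S t (fun y => f y - g y) x = S t f x - S t g x.
Proof. by move=> fb gb; rewrite /S kintB// mulrBr. Qed.

Let SE s t x : 0 <= s -> 0 <= t -> S s (E t) x = E (s + t) x.
Proof. by move=> s0 t0'; rewrite /E Scomp//; exact: bmn_cst. Qed.

Let Sdoeblin f x : bmn f -> c0 * E t0 x * \int[nu]_y f y <= S t0 f x.
Proof.
by move=> fb; rewrite /E /S mulrCA -mulrA ler_wpM2l// doeblin.
Qed.

(** The factor by which [be - al] shrinks over one time step [t0]: [c0 / C] is the Doeblin constant
    relative to [F n.+1], and [m] bounds the [nu]-mass of [F n] from below. The maximum secures
    non-negativity. *)
Let kappa := Num.max 0 (1 - c0 / C * m).

Let kappa_ge0 : 0 <= kappa.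
Proof. by rewrite le_max lexx. Qed.

Let kappa_lt1 : kappa < 1.
Proof. by rewrite gt_max ltr01 gtrBl mulr_gt0// divr_gt0. Qed.

Let F n := E (n.+1%:R * t0).

Let nt0_ge0 n : 0 <= n%:R * t0.
Proof. by rewrite mulr_ge0// ltW. Qed.

Let bmnF n : bmn (F n). Proof. exact: bmnE. Qed.

Let FS n x : F n.+1 x = S t0 (F n) x.
Proof. by rewrite /F SE ?(ltW t0_gt0)// [in LHS]mulrSr mulrDl mul1r addrC. Qed.

Let F_le n x : F n.+1 x <= C * E t0 x.
Proof.
rewrite FS -SZ; last exact: bmn_cst.
by apply: Sle => // [|y]; [apply: bmnZ; [exact: ltW|exact: bmn_cst]|rewrite mulr1 E_le].
Qed.

(** The differences [S s (F n) - al * F n] and [be * F n - S s (F n)] are non-negative, so the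
    Doeblin bound applies to both. Since [c0 * E t0] dominates [c0 / C * F n.+1], each constant can
    be moved inwards by [c0 / C] times the [nu]-mass of its difference. *)
Let sandwich (s : R) (s0 : 0 <= s) n : exists al be : R,
  [/\ 0 <= al <= be, be - al <= C * kappa ^+ n &
      forall x, al * F n x <= S s (F n) x <= be * F n x].
Proof.
elim: n => [|n [al [be [/andP[al0 albe] bal sw]]]].
  exists 0, C; split; first by rewrite lexx ltW.
    by rewrite expr0 mulr1 subr0.
  (* Base case: exchanging the two times, [S s (E t0) = S t0 (E s)], which is at most
     [S t0 C = C * E t0]. *)
  move=> x; rewrite mul0r SE// addrC -SE//; apply/andP; split.
    by rewrite SE// ltW// E_gt0// addr_ge0.
  rewrite /F mul1r -SZ; last exact: bmn_cst.
  apply: Sle => // [|y]; first by apply: bmnZ; [exact: ltW|exact: bmn_cst].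
  by rewrite mulr1 E_le.
pose G := S s (F n); have bG : bmn G by exact: bmnS.
have be0 : 0 <= be by exact: le_trans albe.
have GS x : S s (F n.+1) x = S t0 G x.
  have -> : G = E (s + n.+1%:R * t0) by apply/funext => y; rewrite /G SE.
  rewrite !SE ?addr_ge0 ?(ltW t0_gt0)//.
  by rewrite (_ : s + n.+2%:R * t0 = t0 + (s + n.+1%:R * t0))//; ring.
pose NF := \int[nu]_y F n y; pose NG := \int[nu]_y G y.
have nufin : (nu setT < +oo)%E by rewrite probability_setT ltry.
have bal' := bmnZ al0 (bmnF n); have bbe' := bmnZ be0 (bmnF n).
have lo : al * NF <= NG.
  by rewrite -bmn_intZ//; apply: bmn_int_le => // y; have /andP[] := sw y.
have hi : NG <= be * NF.
  by rewrite -bmn_intZ//; apply: bmn_int_le => // y; have /andP[] := sw y.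
pose de := c0 / C; have de0 : 0 < de by rewrite divr_gt0.
have Et0 x : de * F n.+1 x <= c0 * E t0 x.
  by rewrite /de mulrAC -mulrA ler_wpM2l ?(ltW c0_gt0)// ler_pdivrMr// mulrC F_le.
(* The two gains add up to [de * (be - al) * NF], in which [NG] has cancelled; as [NF >= m], the gap
   contracts by at least [kappa]. *)
pose al' := al + de * (NG - al * NF); pose be' := be - de * (be * NF - NG).
have sw' x : al' * F n.+1 x <= S s (F n.+1) x <= be' * F n.+1 x.
  have F0 : 0 <= F n.+1 x by rewrite ltW// E_gt0.
  apply/andP; split.
    have bu : bmn (fun y => G y - al * F n y).
      by apply: bmnB => // y; have /andP[] := sw y.
    have := Sdoeblin x bu; rewrite SB// SZ// -FS -GS bmn_intB// bmn_intZ//.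
    rewrite -/NG -/NF /al' mulrDl lerBrDl; apply: le_trans; rewrite lerD2l.
    by rewrite mulrAC ler_wpM2r// ?subr_ge0.
  have bu : bmn (fun y => be * F n y - G y).
    by apply: bmnB => // y; have /andP[] := sw y.
  have := Sdoeblin x bu; rewrite SB// SZ// -FS -GS bmn_intB// bmn_intZ//.
  rewrite -/NG -/NF => dbe.
  have hi' : 0 <= be * NF - NG by rewrite subr_ge0.
  have := ler_wpM2r hi' (Et0 x).
  rewrite /be' => k; lra.
have F0 x : 0 < F n.+1 x by exact: E_gt0.
have [x0 _] := probability_inhabited nu.
have albe' : al' <= be'.
  by have /andP[/le_trans] := sw' x0 => /[apply]; rewrite ler_pM2r.
exists al', be'; split => //.
  by rewrite albe' andbT addr_ge0// mulr_ge0 ?subr_ge0// ltW.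
have -> : be' - al' = (be - al) * (1 - de * NF) by rewrite /be' /al'; ring.
rewrite exprSr mulrA; apply: (@le_trans _ _ ((be - al) * kappa)).
  rewrite ler_wpM2l ?subr_ge0// le_max lerD2l lerN2 ler_wpM2l ?orbT//; first exact: ltW.
  exact: E_nu.
by rewrite ler_wpM2r.
Qed.

(* If [S s f <= be * f] with [be < 1], or [al * f <= S s f] with [1 < al], then
   iterating [S s] contradicts the two-sided bounds on [E]. *)
Let sandwich1 (s : R) (s0 : 0 <= s) n al be : 0 <= al -> al <= be ->
  (forall x, al * F n x <= S s (F n) x <= be * F n x) -> al <= 1 <= be.
Proof.
move=> al0 albe sw; have be0 := le_trans al0 albe.
have [x0 _] := probability_inhabited nu.
pose t := n.+1%:R * t0; have t_ge0 : 0 <= t by exact: nt0_ge0.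
have it k x : al ^+ k * E t x <= E (k%:R * s + t) x <= be ^+ k * E t x.
  have ks i : 0 <= i%:R * s by rewrite mulr_ge0.
  elim: k x => [|k IH] x; first by rewrite !expr0 !mul1r mul0r add0r lexx.
  have EE : E (k.+1%:R * s + t) x = S s (E (k%:R * s + t)) x.
    by rewrite SE ?addr_ge0//; congr E; rewrite [in LHS]mulrSr; ring.
  have bE (r : R) : 0 <= r -> bmn (fun y => r * E t y) by move=> r0; exact: bmnZ.
  have /andP[lo hi] := sw x.
  rewrite EE; apply/andP; split.
    apply: (@le_trans _ _ (al ^+ k * S s (E t) x)).
      by rewrite exprSr -mulrA ler_wpM2l ?exprn_ge0.
    rewrite -SZ//; apply: Sle => //; first by apply: bE; rewrite exprn_ge0.
    by move=> y; have /andP[] := IH y.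
  apply: (@le_trans _ _ (be ^+ k * S s (E t) x)); last first.
    by rewrite exprSr -mulrA ler_wpM2l ?exprn_ge0.
  rewrite -SZ//; apply: Sle => //; first by apply: bE; rewrite exprn_ge0.
  by move=> y; have /andP[] := IH y.
have Et_gt0 : 0 < E t x0 by exact: E_gt0.
apply/andP; split.
- rewrite leNgt; apply/negP => al1.
  have al_gt0 : 0 < al by exact: lt_trans al1.
  suff : E t x0 <= 0 by rewrite leNgt Et_gt0.
  apply: (@le_geometric0 _ _ C al^-1); first by rewrite invr_ge0 ltW//= invf_lt1.
  move=> k; rewrite exprVn ler_pdivlMr ?exprn_gt0// mulrC.
  have /andP[/le_trans -> //] := it k x0.
  by rewrite E_le// addr_ge0// mulr_ge0.
- rewrite leNgt; apply/negP => be1.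
  suff : m <= 0 by rewrite leNgt m_gt0.
  apply: (@le_geometric0 _ _ C be); first by rewrite be0.
  move=> k; rewrite (le_trans (E_nu (t := k%:R * s + t) _))//.
    by rewrite addr_ge0// mulr_ge0.
  have nufin : (nu setT < +oo)%E by rewrite probability_setT ltry.
  have CB : 0 <= C * be ^+ k by rewrite mulr_ge0 ?exprn_ge0// ltW.
  apply: le_trans (bmn_int_ub nufin (bmnE _) CB _) _; last first.
    by rewrite [X in fine X]probability_setT mulr1 lexx.
  move=> y; have /andP[_ /le_trans ->//] := it k y.
  by rewrite mulrC ler_wpM2r ?exprn_ge0// E_le.
Qed.

(** Both [1] and the ratio of [S s (F n)] to [F n] lie in [[al, be]], so they differ by at most
    [be - al <= C * kappa ^+ n]; the second factor [C] bounds [F n]. *)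
Let almost_invariant (s : R) n x : 0 <= s ->
  `|S s (F n) x - F n x| <= C ^+ 2 * kappa ^+ n.
Proof.
move=> s0; have [al [be [/andP[al0 albe] bal sw]]] := sandwich s0 n.
have /andP[al1 be1] := sandwich1 s0 al0 albe sw.
have F0 : 0 <= F n x by rewrite ltW// E_gt0.
have FC : F n x <= C by exact: E_le.
have /andP[lo hi] := sw x.
have k : (be - al) * F n x <= C ^+ 2 * kappa ^+ n.
  by rewrite expr2 mulrAC ler_pM ?subr_ge0//.
rewrite ler_norml; apply/andP; split.
  have := ler_wpM2r F0 be1; lra.
have := ler_wpM2r F0 al1; lra.
Qed.

(** Almost invariance at time [t0] bounds [F n.+1 - F n] geometrically and uniformly in [x], which
    produces the limit [h]; almost invariance at an arbitrary time [t] makes this limit invariant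
    under [S t]. *)
Lemma eigenfunction : exists h : T -> R,
  [/\ bmn h, (forall x, 0 < h x),
      (forall t x, 0 <= t -> kint (P t) h x = lam `^ t * h x) &
      forall e, 0 < e -> exists t, 0 <= t /\ forall x, `|h x - E t x| < e].
Proof.
have kap : 0 <= kappa < 1 by rewrite kappa_ge0 kappa_lt1.
have Fgeo x n : `|F n.+1 x - F n x| <= C ^+ 2 * kappa ^+ n.
  by rewrite FS; apply: almost_invariant; exact: ltW.
pose h x := limn (F ^~ x).
have Fh x := (geometric_cvg kap (Fgeo x)).1.
pose K := C ^+ 2 / (1 - kappa).
have hF x n : `|h x - F n x| <= K * kappa ^+ n.
  exact: (geometric_cvg kap (Fgeo x)).2.
have K0 : 0 <= K by rewrite divr_ge0 ?exprn_ge0 ?(ltW C_gt0)// subr_ge0 ltW.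
(* The Doeblin bound applied to [F n] survives in the limit and keeps [h] strictly positive. It
   starts at index 1, the first at which [F] has the form [S t0 (F n)]. *)
have h_lb x : c0 * E t0 x * m <= h x.
  apply: (cvgr_to_ge (Fh x)); exists 1%N => // -[|n] //= _; rewrite FS.
  apply: le_trans (Sdoeblin x (bmnF n)); rewrite ler_wpM2l ?E_nu//.
  by rewrite mulr_ge0 ?ltW// E_gt0// ltW.
have h_gt0 x : 0 < h x.
  apply: lt_le_trans (h_lb x); apply: mulr_gt0 => //; apply: mulr_gt0 => //.
  by apply: E_gt0; exact: ltW.
have bh : bmn h.
  split; last first.
    exists C => x; rewrite ltW//=; apply: (cvgr_to_le (Fh x)).
    by apply: nearW => n; exact: E_le.
  by apply: (@measurable_fun_cvg _ _ _ _ F) => [n|x _]; [exact: (bmnF n).1|exact: Fh].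
exists h; split => // [t x t_ge0|e e0].
  suff : `|S t h x - h x| <= 0.
    rewrite normr_le0 subr_eq0 /S => /eqP <-.
    by rewrite mulrA divff ?mul1r// gt_eqF// powR_gt0.
  (* The three terms control, in order, [S t h - S t (F n)], [S t (F n) - F n] and [F n - h], each
     up to the factor [kappa ^+ n]. *)
  pose B := (lam `^ t)^-1 * K + C ^+ 2 + K.
  apply: (@le_geometric0 _ _ B kappa) => // n.
  rewrite /B !mulrDl.
  have -> : S t h x - h x =
      (S t h x - S t (F n) x) + (S t (F n) x - F n x) + (F n x - h x).
    by ring.
  rewrite (le_trans (ler_normD _ _))// lerD//; last by rewrite distrC.
  rewrite (le_trans (ler_normD _ _))// lerD//; last exact: almost_invariant.
  rewrite /S -mulrBr normrM ger0_norm// -mulrA ler_wpM2l//.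
  have Kn0 : 0 <= K * kappa ^+ n by rewrite mulr_ge0 ?exprn_ge0.
  have bc : bmn (cst (K * kappa ^+ n) : T -> R) by exact: bmn_cst.
  have kc : kint (P t) (cst (K * kappa ^+ n)) x <= K * kappa ^+ n by exact: kint_ub.
  (* The difference [h - F n] may change sign and so leave the class [bmn]; adding the constant to
     one side or the other keeps both comparisons inside it. *)
  rewrite ler_norml; apply/andP; split.
    rewrite lerBrDr addrC lerBlDr; apply: (@le_trans _ _
      (kint (P t) (fun y => h y + cst (K * kappa ^+ n) y) x)).
      apply: kint_le => //; first exact: bmnD.
      by move=> y; have := hF y n; rewrite ler_norml /= => /andP[? _]; lra.
    by rewrite kintD// lerD2l.
  rewrite lerBlDr; apply: (@le_trans _ _
    (kint (P t) (fun y => cst (K * kappa ^+ n) y + F n y) x)).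
    apply: kint_le => //; first exact: bmnD.
    by move=> y; have := hF y n; rewrite ler_norml /= => /andP[_ ?]; lra.
  by rewrite kintD// lerD2r.
have : (fun n => K * kappa ^+ n) n @[n --> \oo] --> K * 0.
  by apply: cvgMl_tmp; apply: cvg_expr; rewrite ger0_norm.
rewrite mulr0 => /cvgrPdist_lt /(_ e e0) [n _ /(_ n (leqnn n))].
have Kn0 : 0 <= K * kappa ^+ n by apply: mulr_ge0 => //; exact: exprn_ge0.
rewrite sub0r normrN ger0_norm// => Kn.
exists (n.+1%:R * t0); split; first exact: nt0_ge0.
by move=> x; apply: le_lt_trans Kn; exact: hF.
Qed.
End eigenfunction.

(** * Open sets, lower semicontinuity and sigma-finiteness *)

Section borel.
Context {R : realType} {d : measure_display} {T : metricMeasurableType R d}.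
Hypothesis borelT : borel_sigma T.
Implicit Types (O U : set T).

Lemma borel_open_measurable U : open U -> measurable U.
Proof. by move=> oU; rewrite borelT; exact: sub_sigma_algebra. Qed.

Lemma borel_continuous_measurable (f : T -> R) :
  continuous f -> measurable_fun [set: T] f.
Proof.
move=> /continuousP cf mT; apply: (measurability _ (RGenOpens.measurableE R)) => //.
move=> _ [_ [a [b ->] <-]]; rewrite setTI; apply: borel_open_measurable.
by apply: cf; exact: interval_open.
Qed.

Lemma ball_metric_open (x : T) (r : R) : open (ball x r).
Proof.
rewrite openE => y; rewrite ballEmdist /= => xy; apply/nbhs_ballP.
exists (r - mdist x y) => /=; first by rewrite subr_gt0.
move=> z; rewrite !ballEmdist /= ltrBrDl; exact/le_lt_trans/metric_triangle.
Qed.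

(** [O] is the increasing union of the sets [F n] of points at distance at least [1/(n+1)] from its
    complement. If [K x0 O > q] then already [K x0 (F n) > q] for some [n], and a continuous [f]
    with [1_(F n) <= f <= 1_O] transfers the lower semicontinuity of [K f] to [O]. *)
Lemma lower_semicontinuous_measure_open (K : R.-spker T ~> T) O :
  lsc_kernel K -> open O -> lower_semicontinuous (fun x => K x O).
Proof.
move=> lK oO x0 q qx0.
pose G (n : nat) := \bigcup_(y in ~` O) ball y n.+1%:R^-1.
pose F n := ~` G n.
have mF n : measurable (F n).
  apply/measurableC/borel_open_measurable/bigcup_open => y _.
  exact: ball_metric_open.
have FO : \bigcup_n F n = O.
  apply/seteqP; split => [x [n _ Fx]|x Ox].
    by apply: contrapT => nOx; apply: Fx; exists x => //; exact: ballxx.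
  have /nbhs_ballP[r /= r0 rO] : nbhs x O by apply: open_nbhs_nbhs.
  have [n _ /(_ n (leqnn n)) nr] := near_infty_natSinv_lt (PosNum r0).
  exists n => // -[y nOy /ball_sym yx]; apply: nOy; apply: rO.
  exact: le_ball (ltW nr) _ yx.
have ndF : nondecreasing_seq F.
  move=> n m nm; apply/subsetPset => x Fx [y Oy yx]; apply: Fx; exists y => //.
  by apply: le_ball yx; rewrite lef_pV2 ?posrE// ler_nat.
have [n qF] : exists n, (q%:E < K x0 (F n))%E.
  apply: contrapT => /forallNP qF; move: qx0; rewrite ltNge => /negP; apply.
  have := @nondecreasing_cvg_mu _ _ _ (K x0) F mF.
  rewrite FO => /(_ (borel_open_measurable oO) ndF) /cvge_to_le; apply.
  by apply: nearW => n; rewrite leNgt; apply/negP; exact: qF.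
have sep : uniform_separator (~` O) (F n).
  apply: uniform_separatorW; exists [set xy | ball xy.1 n.+1%:R^-1 xy.2].
    by have n0 : 0 < n.+1%:R^-1 :> R by []; exact: (@entourage_ball _ _ (PosNum n0)).
  apply/seteqP; split => // -[y x] [[/= nOy Fx] yx]; apply: Fx.
  by exists y.
pose f : T -> R := Urysohn (~` O) (F n).
have cf : continuous f by exact: Urysohn_continuous.
have f01 x : 0 <= f x <= 1.
  have : range f (f x) by exists x.
  by move/Urysohn_range; rewrite /= in_itv.
have mfE : measurable_fun [set: T] (EFin \o f).
  exact/measurable_EFinP/borel_continuous_measurable.
have bf : bmn f by split; [exact: borel_continuous_measurable|exists 1].
have f0 x : (0 <= (f x)%:E)%E by rewrite lee_fin; have /andP[] := f01 x.
have mO := borel_open_measurable oO.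
have KE x A : measurable A -> K x A = (\int[K x]_y (\1_A y)%:E)%E.
  by move=> mA; rewrite integral_indic// setIT.
have fO x : (kact K f x <= K x O)%E.
  rewrite KE//; apply: ge0_le_integral => //; first exact/measurable_EFinP.
  move=> y _; rewrite lee_fin indicE; have [_|/negP nOy] := boolP (y \in O).
    by have /andP[] := f01 y.
  rewrite (_ : f y = 0)//; apply: (Urysohn_sub0 sep); exists y => //.
  by apply: contra_not nOy; exact: mem_set.
have fF : (K x0 (F n) <= kact K f x0)%E.
  rewrite KE//; apply: ge0_le_integral => //; first exact/measurable_EFinP.
  move=> y _; rewrite lee_fin indicE; have [/set_mem Fy|_] := boolP (y \in F n).
    by rewrite (_ : f y = 1)//; apply: (Urysohn_sub1 sep); exists y.
  by have /andP[] := f01 y.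
have f_ge0 x : 0 <= f x by have /andP[] := f01 x.
have [V V0 Vq] := lK f (bmn_bounded bf) cf f_ge0 x0 q (lt_le_trans qF fF).
by exists V => // y Vy; apply: lt_le_trans (Vq y Vy) (fO y).
Qed.

(** Some piece of the exhaustion meets [U] in positive measure, as otherwise [U] would be
    negligible. Finiteness allows [Lam A] to be cancelled in later inequalities. *)
Lemma sigma_finite_pos_subset (Lam : {measure set T -> \bar R}) (U : set T) :
  sigma_finite setT Lam -> measurable U -> (0 < Lam U)%E ->
  exists A, [/\ measurable A, A `<=` U & (0 < Lam A < +oo)%E].
Proof.
move=> [F FT mF] mU U0.
have [n Fn] : exists n, (0 < Lam (U `&` F n))%E.
  apply: contrapT => /forallNP UF; move: U0; apply/negP; rewrite -leNgt.
  have mUF n : measurable (U `&` F n) by apply: measurableI => //; exact: (mF n).1.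
  have /(measure_negligible mU) -> // : Lam.-negligible U.
  rewrite -(setIT U) FT setI_bigcupr; apply: negligible_bigcup => n.
  apply/negligibleP => //; apply/eqP; rewrite eq_le measure_ge0 andbT leNgt.
  exact/negP/UF.
exists (U `&` F n); split => //; first by apply: measurableI => //; exact: (mF n).1.
rewrite Fn/=; apply: le_lt_trans (mF n).2; apply: le_measure => //; rewrite inE.
  by apply: measurableI => //; exact: (mF n).1.
exact: (mF n).1.
Qed.

End borel.

(** * Comparison of integrals, and multiplicative functions on the half-line *)

(** Restricting both measures to [D] turns the hypothesis on subsets of [D] into an inequality
    between measures on the whole space, which integration preserves. *)
Lemma ge0_integral_scale_le {R : realType} {d} {T : measurableType d}
  (mu1 mu2 : {measure set T -> \bar R}) (c : R) (f : T -> \bar R) D :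
  measurable D -> 0 <= c ->
  (forall A, measurable A -> A `<=` D -> (c%:E * mu1 A <= mu2 A)%E) ->
  (forall x, 0 <= f x)%E -> measurable_fun [set: T] f ->
  (c%:E * \int[mu1]_(x in D) f x <= \int[mu2]_(x in D) f x)%E.
Proof.
move=> mD c0 h f0 mf.
have mfD : measurable_fun D f by exact: measurable_funTS.
have -> : (\int[mu1]_(x in D) f x = \int[mrestr mu1 mD]_(x in D) f x)%E.
  by apply: eq_measure_integral => A mA AD; rewrite /= /mrestr (setIidl AD).
rewrite -(ge0_integral_mscale _ mD (NngNum c0))//.
have -> : (\int[mu2]_(x in D) f x = \int[mrestr mu2 mD]_(x in D) f x)%E.
  by apply: eq_measure_integral => A mA AD; rewrite /= /mrestr (setIidl AD).
apply: ge0_le_measure_integral => // A mA.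
rewrite /mscale /mrestr /=; apply: h; first exact: measurableI.
exact: subIsetr.
Qed.

(** Positivity at [t1] spreads to all times through powers and factors of [r (n t1)]. Then [- ln r]
    is additive and, because [r <= 1], monotone, and a monotone solution of Cauchy's equation is
    linear. *)
Lemma multiplicative_powR {R : realType} (r : R -> R) (t1 : R) :
  (forall s t, 0 <= s -> 0 <= t -> r (s + t) = r s * r t) ->
  (forall t, 0 <= t -> 0 <= r t <= 1) -> 0 < t1 -> 0 < r t1 ->
  0 < r 1 /\ forall t, 0 <= t -> r t = r 1 `^ t.
Proof.
move=> rM r01 t1_gt0 rt1.
have r0 : r 0 = 1.
  apply: (mulIf (lt0r_neq0 rt1)).
  by rewrite mul1r -rM ?add0r// ltW.
have rX n t : 0 <= t -> r (n%:R * t) = r t ^+ n.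
  move=> t0; elim: n => [|n IH]; first by rewrite mul0r r0.
  by rewrite exprS -IH -rM ?mulr_ge0// mulrSr mulrDl mul1r addrC.
have r_gt0 t : 0 <= t -> 0 < r t.
  move=> t0; have [n tn] : exists n : nat, t <= n%:R * t1.
    exists (Num.truncn (t / t1)).+1; rewrite -ler_pdivrMr// ltW//.
    by have /andP[] := @truncn_itv _ (t / t1) (divr_ge0 t0 (ltW t1_gt0)).
  have nt : 0 <= n%:R * t1 - t by rewrite subr_ge0.
  have : 0 < r (n%:R * t1) by rewrite rX ?exprn_gt0// ltW.
  rewrite -(subrK t (n%:R * t1)) rM// lt_neqAle eq_sym mulf_eq0 negb_or.
  by move=> /andP[/andP[_ rt] _]; rewrite lt_neqAle eq_sym rt; have /andP[] := r01 _ t0.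
split; first exact: r_gt0.
pose f t := - ln (r t).
have fD s t : 0 <= s -> 0 <= t -> f (s + t) = f s + f t.
  by move=> s0 t0; rewrite /f rM// lnM ?posrE ?r_gt0// opprD.
have fX n t : 0 <= t -> f (n%:R * t) = n%:R * f t.
  by move=> t0; rewrite /f rX// lnXn ?r_gt0// mulrN mulr_natl.
have f_ge0 t : 0 <= t -> 0 <= f t.
  by move=> t0; rewrite /f oppr_ge0 ln_le0//; have /andP[] := r01 _ t0.
have f_mono s t : 0 <= s -> s <= t -> f s <= f t.
  move=> s0 st; rewrite -(subrK s t) fD ?subr_ge0// lerDr f_ge0//.
  by rewrite subr_ge0.
have fn (n : nat) : f n%:R = n%:R * f 1 by rewrite -fX ?mulr1.
(* With [k] the integer part of [(n+1) t], both [(n+1) f t] and [(n+1) t f 1] lie between [k f 1]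
   and [(k+1) f 1]; dividing by [n+1] forces [f t = t f 1]. *)
have close t n : 0 <= t -> `|n.+1%:R * (f t - t * f 1)| <= f 1.
  move=> t0; pose k := Num.truncn (n.+1%:R * t).
  have nt0 : 0 <= n.+1%:R * t by rewrite mulr_ge0.
  have /andP[k1 k2] := truncn_itv nt0.
  have f10 : 0 <= f 1 by exact: f_ge0.
  have h1 : k%:R * f 1 <= n.+1%:R * f t by rewrite -fn -fX// f_mono.
  have h2 : n.+1%:R * f t <= k.+1%:R * f 1 by rewrite -fn -fX// f_mono// ltW.
  have h3 := ler_wpM2r f10 k1.
  have h4 := ler_wpM2r f10 (ltW k2).
  rewrite mulrSr mulrDl mul1r in h2; rewrite [k.+1%:R]mulrSr mulrDl mul1r in h4.
  by rewrite mulrBr mulrA ler_norml -/k in h3 h4 *; lra.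
move=> t t0.
suff : f t = t * f 1.
  rewrite /f mulrN => /oppr_inj ft.
  by rewrite /powR gt_eqF ?r_gt0// -ft lnK// posrE r_gt0.
apply/eqP; rewrite -subr_eq0 -normr_le0 leNgt; apply/negP => gt0.
have f1_ge0 : 0 <= f 1 / `|f t - t * f 1| by rewrite divr_ge0// f_ge0.
pose n := Num.truncn (f 1 / `|f t - t * f 1|).
have /andP[_] := truncn_itv f1_ge0; rewrite -/n ltr_pdivrMr// ltNge => /negP; apply.
by have := close t n t0; rewrite normrM ger0_norm.
Qed.

(** * Survival probabilities under a quasi-stationary distribution *)

Section qsd.
Context {R : realType} {d : measure_display} {T : measurableType d}.
Variables (Q : R -> R.-spker T ~> T) (mu : probability T R).
Hypothesis Q_add : forall s t x A, 0 <= s -> 0 <= t -> measurable A ->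
  Q (s + t) x A = (\int[Q s x]_y Q t y A)%E.
Hypothesis qsd : forall t, 0 <= t -> forall A, measurable A ->
  (\int[mu]_y Q t y A = (\int[mu]_y Q t y setT) * mu A)%E.

Definition survival t : R := fine (\int[mu]_y Q t y setT).

Lemma survival_bounds t : (0 <= \int[mu]_y Q t y setT <= 1)%E.
Proof.
rewrite integral_ge0//=; apply: (@le_trans _ _ (\int[mu]__ 1)%E).
  apply: ge0_le_integral => //; first exact: measurable_kernel.
  by move=> x _; exact: sprob_kernel_le1.
by rewrite integral_cst// mul1e [leLHS]probability_setT.
Qed.

Lemma survivalE t : (\int[mu]_y Q t y setT)%E = (survival t)%:E.
Proof.
have /andP[r0 r1] := survival_bounds t.
by rewrite fineK// ge0_fin_numE// (le_lt_trans r1)// ltry.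
Qed.

Lemma survival_ge0_le1 t : 0 <= survival t <= 1.
Proof. by rewrite -!lee_fin -survivalE survival_bounds. Qed.

(** Starting from [mu], the law at time [s] is [survival s * mu], so survival for a further time [t]
    contributes the factor [survival t]. *)
Lemma survivalD s t : 0 <= s -> 0 <= t ->
  survival (s + t) = survival s * survival t.
Proof.
move=> s0 t0; apply/EFin_inj; rewrite EFinM -!survivalE.
have /andP[rs0 _] := survival_ge0_le1 s.
under eq_integral do rewrite Q_add//.
rewrite survivalE -(ge0_integral_mscale mu measurableT (NngNum rs0))//.
- apply/esym/ge0_integral_mixture => //; last exact: measurable_kernel.
  by move=> A mA; rewrite qsd// survivalE.
- exact: measurable_kernel.
Qed.

End qsd.

(** * Bounds obtained from duality with the adjoint kernel *)

Section duality.
Context {R : realType} {d : measure_display} {T : measurableType d}.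
Variables (Lam : {measure set T -> \bar R}) (K Kt : R.-spker T ~> T).
Variables (psi : T -> R) (a e b r M c1 : R) (mu : probability T R) (O : set T).
Hypothesis mpsi : measurable_fun [set: T] psi.
Hypothesis e0 : 0 < e.
Hypothesis psi_eb : forall x, e <= psi x <= b.
Hypothesis a0 : 0 <= a.
Hypothesis dual : forall A B, measurable A -> measurable B ->
  (\int[Lam]_(x in A) ((psi x)%:E * K x B) =
   a%:E * \int[Lam]_(y in B) ((psi y)%:E * Kt y A))%E.
Hypothesis r0 : 0 <= r.
Hypothesis qsd : forall A, measurable A -> (\int[mu]_y Kt y A = r%:E * mu A)%E.
Hypothesis M0 : 0 <= M.
Hypothesis mu_le : forall A, measurable A -> (mu A <= M%:E * Lam A)%E.

Let psi0 x : 0 <= psi x.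
Proof. by have /andP[ep _] := psi_eb x; rewrite (le_trans (ltW e0)). Qed.

Let mK A : measurable A -> measurable_fun [set: T] (K ^~ A).
Proof. exact: measurable_kernel. Qed.

Let mKt A : measurable A -> measurable_fun [set: T] (Kt ^~ A).
Proof. exact: measurable_kernel. Qed.

Let mpsiE : measurable_fun [set: T] (fun x => (psi x)%:E).
Proof. exact/measurable_EFinP. Qed.

Let psi_lower (g : T -> \bar R) D : measurable D -> measurable_fun [set: T] g ->
  (forall x, 0 <= g x)%E ->
  (e%:E * \int[Lam]_(x in D) g x <= \int[Lam]_(x in D) ((psi x)%:E * g x))%E.
Proof.
move=> mD mg g0; have mgD : measurable_fun D g by exact: measurable_funTS.
rewrite -ge0_integralZl_EFin//; last exact: ltW.
apply: ge0_le_integral => //.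
- by move=> x _; rewrite mule_ge0// lee_fin ltW.
- by apply: measurable_funeM.
- by apply: emeasurable_funM => //; exact: measurable_funTS.
- by move=> x _; rewrite lee_wpmul2r// lee_fin; have /andP[] := psi_eb x.
Qed.

Let psi_upper (g : T -> \bar R) D : measurable D -> measurable_fun [set: T] g ->
  (forall x, 0 <= g x)%E -> 0 <= b ->
  (\int[Lam]_(x in D) ((psi x)%:E * g x) <= b%:E * \int[Lam]_(x in D) g x)%E.
Proof.
move=> mD mg g0 b_ge0; have mgD : measurable_fun D g by exact: measurable_funTS.
rewrite -ge0_integralZl_EFin//.
apply: ge0_le_integral => //.
- by move=> x _; rewrite mule_ge0// lee_fin.
- by apply: emeasurable_funM => //; exact: measurable_funTS.
- by apply: measurable_funeM.
- by move=> x _; rewrite lee_wpmul2r// lee_fin; have /andP[] := psi_eb x.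
Qed.

(** Insert [psi >= e], exchange [A] and [O] by duality, use [psi <= b], replace [Lam] on [O] by
    [mu / c1], and conclude with quasi-stationarity and [mu <= M * Lam]. *)
Lemma dual_upper A : measurable A -> measurable O -> 0 < c1 -> 0 <= b ->
  (forall A, measurable A -> (c1%:E * Lam (A `&` O) <= mu A)%E) ->
  ((c1 * e)%:E * \int[Lam]_(x in A) K x O <= (a * b * r * M)%:E * Lam A)%E.
Proof.
move=> mA mO c1_gt0 b_ge0 c1O.
have h1 : (e%:E * \int[Lam]_(x in A) K x O <=
    a%:E * (b%:E * \int[Lam]_(x in O) Kt x A))%E.
  apply: le_trans (psi_lower mA (mK mO) _) _ => //.
  by rewrite dual// lee_wpmul2l// psi_upper//; exact: mKt.
have h2 : (c1%:E * \int[Lam]_(x in O) Kt x A <= (r * M)%:E * Lam A)%E.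
  apply: le_trans (ge0_integral_scale_le (mu2 := mu) mO (ltW c1_gt0) _ _ _) _.
  - by move=> B mB BO; have := c1O B mB; rewrite (setIidl BO).
  - by [].
  - exact: mKt.
  - apply: le_trans (ge0_subset_integral mu mO measurableT (mKt mA) _ _) _ => //.
    by rewrite qsd// EFinM -muleA lee_wpmul2l// mu_le.
have := lee_wpmul2l (ltW c1_gt0 : (0 <= c1%:E)%E) h1.
rewrite muleA -EFinM => /le_trans; apply.
have ab0 : (0 <= (a * b)%:E)%E by rewrite lee_fin mulr_ge0.
have -> : ((a * b * r * M)%:E * Lam A = (a * b)%:E * ((r * M)%:E * Lam A))%E.
  by rewrite muleA -EFinM !mulrA.
apply: le_trans (lee_wpmul2l ab0 h2).
by rewrite EFinM -muleA (muleCA c1%:E) (muleCA c1%:E).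
Qed.

(** The reverse chain, with the whole space in place of [O]: [r * mu A] is the [mu]-integral of
    [Kt y A], at most [M] times its [Lam]-integral, and duality carries this to the integral of
    [K x setT] over [A]. *)
Lemma dual_lower A : measurable A -> 0 <= b ->
  ((a * e * r)%:E * mu A <= (M * b)%:E * \int[Lam]_(x in A) K x setT)%E.
Proof.
move=> mA b_ge0.
have h1 : (a%:E * (e%:E * \int[Lam]_x Kt x A) <= b%:E * \int[Lam]_(x in A) K x setT)%E.
  apply: le_trans (psi_upper mA (mK measurableT) _ b_ge0) => //.
  rewrite dual// lee_wpmul2l// psi_lower//; exact: mKt.
have h2 : (r%:E * mu A <= M%:E * \int[Lam]_x Kt x A)%E.
  rewrite -qsd// -(ge0_integral_mscale Lam measurableT (NngNum M0))//; last exact: mKt.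
  by apply: ge0_le_measure_integral => //; exact: mKt.
have ae0 : (0 <= (a * e)%:E)%E by rewrite lee_fin mulr_ge0// ltW.
rewrite EFinM -muleA; apply: le_trans (lee_wpmul2l ae0 h2) _.
rewrite [(M * b)%:E]EFinM -[leRHS]muleA.
have ME0 : (0 <= M%:E)%E by rewrite lee_fin.
apply: le_trans (lee_wpmul2l ME0 h1).
by rewrite EFinM -muleA (muleCA e%:E) (muleCA a%:E).
Qed.

End duality.

(** * Two-sided bounds on the rescaled survival probabilities *)

Section bounds.
Context {R : realType} {d : measure_display} {T : metricMeasurableType R d}.
Variables (Lam : {measure set T -> \bar R}) (P Pt : R -> R.-spker T ~> T).
Variables (psi : T -> R) (a e b M c0 t0 c1 t1 : R).
Variables (pit nu : probability T R) (O : set T).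
Hypothesis borelT : borel_sigma T.
Hypothesis sLam : sigma_finite setT Lam.
Hypothesis fullLam : forall U : set T, open U -> U !=set0 -> (0 < Lam U)%E.
Hypothesis sgP : submarkov_semigroup P.
Hypothesis P_gt0 : forall x t, 0 <= t -> (0 < P t x setT)%E.
Hypothesis c0_gt0 : 0 < c0.
Hypothesis t0_gt0 : 0 < t0.
Hypothesis minor : forall x A, measurable A -> (c0%:E * nu A <= condK (P t0) x A)%E.
Hypothesis lscP : forall t, 0 <= t -> lsc_kernel (P t).
Hypothesis cpsi : continuous psi.
Hypothesis e_gt0 : 0 < e.
Hypothesis psi_eb : forall x, e <= psi x <= b.
Hypothesis a_gt0 : 0 < a.
Hypothesis sgPt : submarkov_semigroup Pt.
Hypothesis dual : forall t, 0 <= t -> forall A B, measurable A -> measurable B ->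
  (\int[Lam]_(x in A) ((psi x)%:E * P t x B) =
   (a `^ t)%:E * \int[Lam]_(y in B) ((psi y)%:E * Pt t y A))%E.
Hypothesis qsd : forall t, 0 <= t -> forall A, measurable A ->
  (\int[pit]_y Pt t y A = (\int[pit]_y Pt t y setT) * pit A)%E.
Hypothesis M_gt0 : 0 < M.
Hypothesis pit_le : forall A, measurable A -> (pit A <= M%:E * Lam A)%E.
Hypothesis oO : open O.
Hypothesis c1_gt0 : 0 < c1.
Hypothesis t1_gt0 : 0 < t1.
Hypothesis pit_ge : forall A, measurable A -> (c1%:E * Lam (A `&` O) <= pit A)%E.
Hypothesis hitO : (0 < \int[nu]_x P t1 x O)%E.

Let mO : measurable O. Proof. exact: borel_open_measurable. Qed.

Let mpsi : measurable_fun [set: T] psi.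
Proof. exact: borel_continuous_measurable. Qed.

Let r t := survival Pt pit t.

Let r_ge0 t : 0 <= r t.
Proof. by have /andP[] := survival_ge0_le1 Pt pit t. Qed.

Let at_ge0 t : 0 <= a `^ t. Proof. exact: powR_ge0. Qed.

Let qsdr t : 0 <= t -> forall A, measurable A ->
  (\int[pit]_y Pt t y A = (r t)%:E * pit A)%E.
Proof. by move=> t_ge0 A mA; rewrite qsd// survivalE. Qed.

Let b_gt0 : 0 < b.
Proof.
have [x _] := probability_inhabited nu; have /andP[ep pb] := psi_eb x.
by rewrite (lt_le_trans e_gt0)// (le_trans ep).
Qed.

Let C1 := b * M / (c1 * e).

Let C1_gt0 : 0 < C1. Proof. by rewrite divr_gt0// mulr_gt0. Qed.

Let PE t x A : measurable A -> (fine (P t x A))%:E = P t x A.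
Proof.
move=> mA; rewrite fineK// ge0_fin_numE//.
apply: le_lt_trans (spker_fin (P t) x); apply: le_measure => //; rewrite inE //.
Qed.

(* The duality gives the bound Lam-almost everywhere; as [P t x O] is lower
   semicontinuous in [x] and [Lam] has full support, it then holds everywhere. *)
Let PO_le t x : 0 <= t -> (P t x O <= (C1 * (a `^ t * r t))%:E)%E.
Proof.
move=> t_ge0; set q := C1 * _.
rewrite leNgt; apply/negP; rewrite -PE// lte_fin => qP.
pose q' := (q + fine (P t x O)) / 2.
have [qq' q'P] : q < q' /\ q' < fine (P t x O) by split; rewrite midf_lt.
have /lower_semicontinuousP/(_ q') oU :=
  lower_semicontinuous_measure_open borelT (lscP t_ge0) oO.
set U := [set y | (q'%:E < P t y O)%E] in oU.
have mU := borel_open_measurable borelT oU.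
have [A [mA AU /andP[A0 Afin]]] : exists A,
    [/\ measurable A, A `<=` U & (0 < Lam A < +oo)%E].
  apply: sigma_finite_pos_subset => //; apply: fullLam => //; exists x.
  by rewrite /U /= -PE// lte_fin.
have mPO : measurable_fun [set: T] ((P t)^~ O) by exact: measurable_kernel.
have := dual_upper mpsi e_gt0 psi_eb (at_ge0 t) (dual t_ge0) (r_ge0 t) (qsdr t_ge0)
  pit_le mA mO c1_gt0 (ltW b_gt0) pit_ge.
have q'A : (q'%:E * Lam A <= \int[Lam]_(y in A) P t y O)%E.
  rewrite -integral_cst//; apply: ge0_le_integral => //.
  - move=> y _; rewrite lee_fin (le_trans _ (ltW qq'))// mulr_ge0// ?(ltW C1_gt0)//.
    by rewrite mulr_ge0.
  - exact: measurable_funTS.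
  - by move=> y /AU /= /ltW.
have c1e : (0 < (c1 * e)%:E)%E by rewrite lte_fin mulr_gt0.
move=> /(le_trans (lee_wpmul2l (ltW c1e) q'A)).
have LA : Lam A \is a fin_num by rewrite ge0_fin_numE// ltW.
have LA0 : 0 < fine (Lam A) by rewrite fine_gt0// A0.
rewrite -(fineK LA) -!EFinM lee_fin mulrA ler_pM2r//.
have -> : a `^ t * b * r t * M = c1 * e * q.
  by rewrite /q /C1; field; rewrite !gt_eqF.
by rewrite ler_pM2l ?mulr_gt0// leNgt qq'.
Qed.

Let u t : T -> R := kint (P t) \1_O.
Let S t : T -> R := kint (P t) (cst 1).

Let bmn_indic A : measurable A -> bmn (\1_A : T -> R).
Proof.
move=> mA; split => //; exists 1 => x.
by rewrite indicE; case: (x \in A); rewrite /= ?lexx ?ler01.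
Qed.

Let bmn1 : bmn (cst 1 : T -> R). Proof. exact: bmn_cst. Qed.

Let kint_indic t A x : measurable A -> (kint (P t) \1_A x)%:E = P t x A.
Proof. by move=> mA; rewrite -kint_EFin ?integral_indic ?setIT//; exact: bmn_indic. Qed.

Let SE t x : (S t x)%:E = P t x setT.
Proof. by rewrite -kint_EFin// -[RHS]mul1e -integral_cst. Qed.

Let bmnu t : bmn (u t). Proof. by apply: bmn_kint; exact: bmn_indic. Qed.
Let bmnS t : bmn (S t). Proof. exact: bmn_kint. Qed.

Let u_le t x : 0 <= t -> u t x <= C1 * (a `^ t * r t).
Proof. by move=> t_ge0; rewrite -lee_fin kint_indic// PO_le. Qed.

Let S_gt0 t x : 0 <= t -> 0 < S t x.
Proof. by move=> t_ge0; rewrite -lte_fin SE P_gt0. Qed.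

Let S_le1 t x : S t x <= 1.
Proof. by apply: kint_ub. Qed.

Let nufin : (nu setT < +oo)%E. Proof. by rewrite probability_setT ltry. Qed.

Lemma process_comp s t f x : 0 <= s -> 0 <= t -> bmn f ->
  kint (P (s + t)) f x = kint (P s) (kint (P t) f) x.
Proof. by move=> s_ge0 t_ge0 fb; apply: kint_comp => // A mA; exact: sgP.2. Qed.

(** The conditional minorization, multiplied by the positive survival probability at [t0] and passed
    from sets to functions. *)
Lemma process_doeblin f x : bmn f ->
  c0 * kint (P t0) (cst 1) x * \int[nu]_y f y <= kint (P t0) f x.
Proof.
move=> fb; rewrite -/(S t0 x) -lee_fin -kint_EFin// EFinM -(bmn_EFin nufin fb).
have Sx := S_gt0 x (ltW t0_gt0).
apply: ge0_integral_scale_le => //.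
- by rewrite mulr_ge0// ltW.
- move=> A mA _; have := minor x mA; rewrite /condK -SE /= lee_pdivlMr//.
  by rewrite EFinM -!muleA (muleC (nu A)).
- by move=> y; rewrite lee_fin; case: fb => _ [N /(_ y)/andP[]].
- by apply/measurable_EFinP; case: fb.
Qed.

Let p := \int[nu]_y u t1 y.

Let p_gt0 : 0 < p.
Proof.
rewrite -lte_fin -bmn_EFin//.
by under eq_integral do rewrite kint_indic//.
Qed.

(** At [t = t0] this is the Doeblin bound for [u t1], whose [nu]-integral is [p]; applying
    [P (t - t0)] to both sides gives later times. *)
Let S_le_u t x : t0 <= t -> c0 * p * S t x <= u (t + t1) x.
Proof.
move=> tt0; have st : 0 <= t - t0 by rewrite subr_ge0.
have h y : c0 * p * S t0 y <= u (t0 + t1) y.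
  rewrite /u process_comp ?(ltW t0_gt0) ?(ltW t1_gt0)//; last exact: bmn_indic.
  by rewrite mulrAC; exact: process_doeblin.
have ic : 0 <= c0 * p by rewrite mulr_ge0// ltW.
have -> : S t x = kint (P (t - t0)) (S t0) x.
  by rewrite -process_comp ?(ltW t0_gt0)// subrK.
have -> : u (t + t1) x = kint (P (t - t0)) (u (t0 + t1)) x.
  have t01 : 0 <= t0 + t1 by rewrite addr_ge0// ltW.
  by rewrite -process_comp ?addrA ?subrK//; exact: bmn_indic.
rewrite -kintZ; last exact: bmnS.
by apply: kint_le => //; apply: bmnZ.
Qed.

(** Only positivity at one time is at stake: if [r] vanished at [t0 + t1], then [u (t0 + t1)] would
    vanish by its upper bound, against the lower bound [c0 * p * S t0 > 0]. *)
Lemma survival_powR : 0 < r 1 /\ forall t, 0 <= t -> r t = r 1 `^ t.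
Proof.
apply: (@multiplicative_powR _ r (t0 + t1)).
- by move=> s t s_ge0 t_ge0; apply: survivalD => //; exact: sgPt.2.
- by move=> t _; exact: survival_ge0_le1.
- by rewrite addr_gt0.
have [x _] := probability_inhabited nu.
rewrite lt_neqAle r_ge0 andbT; apply/negP => /eqP r0.
have := S_le_u x (lexx t0); rewrite leNgt => /negP; apply.
apply: le_lt_trans (u_le x _) _; first by rewrite addr_ge0// ltW.
by rewrite -r0 !mulr0 !mulr_gt0// S_gt0// ltW.
Qed.

Let lam := a * r 1.

Let lam_gt0 : 0 < lam. Proof. by rewrite mulr_gt0// survival_powR.1. Qed.

Let lamE t : 0 <= t -> a `^ t * r t = lam `^ t.
Proof. by move=> t_ge0; rewrite survival_powR.2// powRM// ltW. Qed.

Let E t x := (lam `^ t)^-1 * S t x.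

Lemma scaled_survival_bounded : exists2 C, 0 < C & forall t x, 0 <= t -> E t x <= C.
Proof.
(* [Ca] serves for [t >= t0], combining [c0 * p * S t <= u (t + t1)] with the bound on [u]. [Cb]
   serves for [t < t0], where [S t <= 1] and [lam^-t] is at most [exp (t0 |ln lam|)]. *)
pose Ca := C1 * lam `^ t1 / (c0 * p); pose Cb := expR (t0 * `|ln lam|).
have Ca_gt0 : 0 < Ca by apply: divr_gt0; apply: mulr_gt0 => //; exact: powR_gt0.
exists (Ca + Cb); first by rewrite addr_gt0// expR_gt0.
move=> t x t_ge0; have lt := powR_gt0 t lam_gt0.
have Ca0 := ltW Ca_gt0.
have [tt0|tt0] := leP t0 t.
  rewrite (@le_trans _ _ Ca)// ?lerDl ?expR_ge0//.
  rewrite /E mulrC ler_pdivrMr// /Ca mulrAC ler_pdivlMr ?mulr_gt0// mulrC.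
  rewrite (le_trans (S_le_u x tt0))// (le_trans (u_le x _)) ?addr_ge0 ?(ltW t1_gt0)//.
  rewrite lamE ?addr_ge0 ?(ltW t1_gt0)// powRD ?(gt_eqF lam_gt0) ?implybT//.
  by rewrite mulrA mulrAC.
rewrite (@le_trans _ _ Cb)// ?lerDr//.
rewrite /E -[leRHS]mulr1 ler_pM ?invr_ge0 ?(ltW lt)//; first by rewrite ltW// S_gt0.
rewrite -powRN /powR gt_eqF// ler_expR.
apply: (@le_trans _ _ (t * `|ln lam|)).
  by rewrite mulNr -mulrN ler_wpM2l// -normrN ler_norm.
by rewrite ler_wpM2r// ltW.
Qed.

(** Half of the constant that [dual_lower] yields on [O]; the factor 2 makes the later contradiction
    strict. *)
Let w := e * c1 / (2 * M * b).

Let w_gt0 : 0 < w. Proof. by rewrite divr_gt0// !mulr_gt0. Qed.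

(** The part [N] of [O] where [S t <= w * lam^t] is [Lam]-null by [dual_lower], hence null for
    [nu P_t1]. So [nu P_t1] charges [O] outside [N] with mass [p], and [S t >= P_t1 (S t)] gives the
    bound [w * p]. *)
Lemma scaled_survival_lower :
  exists2 m, 0 < m & forall t, 0 <= t -> m <= \int[nu]_y E t y.
Proof.
exists (w * p); first by rewrite mulr_gt0.
move=> t t_ge0; have lt := powR_gt0 t lam_gt0.
pose N := O `&` [set x | S t x <= w * lam `^ t].
have mN : measurable N.
  apply: measurableI => //; rewrite -[X in measurable X]setTI.
  by have := (bmnS t).1 measurableT _ (measurable_itv `]-oo, (w * lam `^ t)]);
    rewrite set_itvNyc.
have LN : Lam N = 0.
  have c1N : (c1%:E * Lam N <= pit N)%E.
    by have := pit_ge mN; rewrite setIidl//; exact: subIsetl.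
  (* Since [c1 * Lam N <= pit N <= 1], the mass [Lam N] is finite and can be cancelled below. *)
  have LNfin : Lam N \is a fin_num.
    rewrite ge0_fin_numE//; move: c1N; rewrite -lee_pdivlMl// => /le_lt_trans; apply.
    rewrite lte_mul_pinfty// ?lee_fin ?invr_ge0 ?(ltW c1_gt0)//.
    by rewrite (le_lt_trans (probability_le1 pit mN))// ltry.
  have SN : (\int[Lam]_(x in N) P t x setT <= (w * lam `^ t)%:E * Lam N)%E.
    rewrite -integral_cst//; apply: ge0_le_integral => //.
      by apply: measurable_funTS; exact: measurable_kernel.
    by move=> x [_ /=]; rewrite -SE lee_fin.
  have := dual_lower mpsi e_gt0 psi_eb (at_ge0 t) (dual t_ge0) (qsdr t_ge0)
    (ltW M_gt0) pit_le mN (ltW b_gt0).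
  have Mb : (0 <= (M * b)%:E)%E by rewrite lee_fin mulr_ge0// ltW.
  move=> /le_trans /(_ (lee_wpmul2l Mb SN)).
  have aer : (0 <= (a `^ t * e * r t)%:E)%E by rewrite lee_fin !mulr_ge0// ltW.
  move=> /(le_trans (lee_wpmul2l aer c1N)).
  have L0 : 0 <= fine (Lam N) by rewrite fine_ge0.
  rewrite -(fineK LNfin) -!EFinM lee_fin => LL; congr EFin.
  apply/eqP; rewrite eq_le L0 andbT leNgt; apply/negP => Lgt0.
  move: LL; rewrite !mulrA ler_pM2r// leNgt => /negP; apply.
  rewrite [ltRHS](_ : _ = e * c1 * (a `^ t * r t)); last by ring.
  rewrite lamE// [ltLHS](_ : _ = (e * c1 * lam `^ t) / 2); last first.
    by rewrite /w; field; rewrite !gt_eqF.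
  by rewrite ltr_pdivrMr// ltr_pMr ?ltr1n// !mulr_gt0.
have bN := bmn_indic mN.
(* Otherwise the minorization makes [P (t0 + t1) x N] positive for every [x]. By duality its
   [psi * Lam]-integral is an integral over the null set [N], hence zero, so [Lam] would vanish on
   the whole space. *)
have vN : \int[nu]_y kint (P t1) \1_N y = 0.
  apply/eqP; rewrite eq_le bmn_int_ge0 ?andbT//; last exact: bmn_kint.
  rewrite leNgt; apply/negP => V0.
  have PN x : (0 < P (t0 + t1) x N)%E.
    rewrite -kint_indic// lte_fin process_comp ?(ltW t0_gt0) ?(ltW t1_gt0)//.
    apply: lt_le_trans (process_doeblin x (bmn_kint _ bN)).
    by rewrite !mulr_gt0// S_gt0// ltW.
  have mf : measurable_fun [set: T] (fun x => (psi x)%:E * P (t0 + t1) x N)%E.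
    by apply: emeasurable_funM; [exact/measurable_EFinP|exact: measurable_kernel].
  have f_gt0 x : (0 < (psi x)%:E * P (t0 + t1) x N)%E.
    rewrite mule_gt0// lte_fin; have /andP[ep _] := psi_eb x.
    exact: lt_le_trans ep.
  have I0 : (\int[Lam]_x `|(psi x)%:E * P (t0 + t1) x N|)%E = 0%E.
    under eq_integral do rewrite gee0_abs ?(ltW (f_gt0 _))//.
    rewrite dual ?addr_ge0 ?(ltW t0_gt0) ?(ltW t1_gt0)//.
    rewrite null_set_integral ?mule0//.
    apply: measurable_funTS; apply: emeasurable_funM; first exact/measurable_EFinP.
    exact: measurable_kernel.
  have [B [mB B0 /= NB]] := (ae_eq_integral_abs Lam measurableT mf).1 I0.
  have BT : B = setT.
    apply/seteqP; split => // x _; apply: NB => /= /(_ Logic.I) fx.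
    by have := f_gt0 x; rewrite fx ltxx.
  have [x _] := probability_inhabited nu.
  have := fullLam openT (ex_intro _ x Logic.I).
  by rewrite -BT B0 ltxx.
have wl0 : 0 <= w * lam `^ t by rewrite mulr_ge0// ltW.
have h1 x : w * lam `^ t * \1_O x <= S t x + w * lam `^ t * \1_N x.
  rewrite !indicE; have [/set_mem Ox|_] := boolP (x \in O); last first.
    by rewrite mulr0; apply: addr_ge0; [exact/ltW/S_gt0|exact: mulr_ge0].
  have [_|/negP xN] := boolP (x \in N); first by rewrite mulr1 lerDr ltW// S_gt0.
  rewrite mulr1 mulr0 addr0 leNgt; apply/negP => Sx.
  by apply: xN; apply/mem_set; split => //=; exact: ltW.
have bO := bmn_indic mO.
have h2 x : w * lam `^ t * u t1 x <= S t x + w * lam `^ t * kint (P t1) \1_N x.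
  (* Survival decreases in time: [P_t1 P_t 1 = P_t P_t1 1 <= P_t 1]. *)
  have St : kint (P t1) (S t) x <= S t x.
    rewrite /S -process_comp ?(ltW t1_gt0)// addrC process_comp ?(ltW t1_gt0)//.
    apply: kint_le => //; first exact: bmn_kint.
    by move=> y; exact: S_le1.
  rewrite /u -kintZ// -kintZ//.
  apply: le_trans (lerD St (lexx _)); rewrite -kintD//; last exact: bmnZ.
  by apply: kint_le => //; [exact: bmnZ|apply: bmnD => //; exact: bmnZ].
rewrite bmn_intZ// [leRHS]mulrC ler_pdivlMr// mulrAC.
have bKN := bmn_kint (P t1) bN.
rewrite -bmn_intZ//; apply: (@le_trans _ _
  (\int[nu]_y (S t y + w * lam `^ t * kint (P t1) \1_N y))).
  by apply: bmn_int_le => //; [exact: bmnZ|apply: bmnD => //; exact: bmnZ].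
by rewrite bmn_intD ?bmn_intZ ?vN ?mulr0 ?addr0//; exact: bmnZ.
Qed.

Lemma exists_eigenfunction : 0 < lam /\ exists h : T -> R,
  [/\ bmn h, (forall x, 0 < h x),
      (forall t x, 0 <= t -> kint (P t) h x = lam `^ t * h x) &
      forall eps, 0 < eps -> exists t, 0 <= t /\
        forall x, `|h x - (lam `^ t)^-1 * kint (P t) (cst 1) x| < eps].
Proof.
split => //.
have [C C_gt0 EC] := scaled_survival_bounded.
have [m m_gt0 Em] := scaled_survival_lower.
apply: (@eigenfunction _ _ _ P nu lam t0 c0 C m) => //.
- exact: process_comp.
- exact: process_doeblin.
- by move=> t x t_ge0; rewrite mulr_gt0 ?invr_gt0 ?powR_gt0// S_gt0.
Qed.

End bounds.

(** * Uniform limits and conclusion *)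

Lemma bounded_fun_norm_le {R : realType} {T : Type} (f : T -> R) :
  bounded_fun f -> exists2 M, 0 < M & forall x, `|f x| <= M.
Proof.
move=> [M [_ fM]]; exists (Num.max M 0 + 1).
  by rewrite ltr_wpDl// le_max lexx orbT.
move=> x; apply: fM => //; apply: le_lt_trans (_ : Num.max M 0 < _).
  by rewrite le_max lexx.
by rewrite ltrDl.
Qed.

Lemma uniform_approx_continuous_at {R : realType} {T : topologicalType}
    (h : T -> R) (x : T) :
  (forall eps : R, 0 < eps -> exists f : T -> R, {for x, continuous f} /\
     forall y, `|h y - f y| < eps) ->
  {for x, continuous h}.
Proof.
move=> hf; apply/cvgrPdist_lt => eps eps0.
have eps3 : 0 < eps / 3 by rewrite divr_gt0.
have [f [/cvgrPdist_lt /(_ _ eps3) cf fh]] := hf _ eps3.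
near=> y.
have -> : h x - h y = (h x - f x) + (f x - f y) + (f y - h y) by ring.
have -> : eps = eps / 3 + eps / 3 + eps / 3 by field.
rewrite (le_lt_trans (ler_normD _ _))// ltrD//; last by rewrite distrC.
rewrite (le_lt_trans (ler_normD _ _))// ltrD//.
by near: y.
Unshelve. all: by end_near. Qed.

Theorem mainTheorem13 (R : realType) (d : measure_display)
  (T : metricMeasurableType R d)
  (Lam : {measure set T -> \bar R})
  (P : R -> R.-spker T ~> T)
  (psi : T -> R) (a : R) (Pt : R -> R.-spker T ~> T)
  (pit : probability T R)
  (c0 t0 : R) (nu : probability T R)
  (O : set T) (c1 t1 : R) :
  (* chi metric space with Borel sigma-algebra; Lam sigma-finite, full support *)
  borel_sigma T ->
  sigma_finite setT Lam ->
  (forall U : set T, open U -> U !=set0 -> (0 < Lam U)%E) ->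
  (* (P_t) is the submarkovian semigroup of the killed process *)
  submarkov_semigroup P ->
  (* Assumption (E) *)
  separable T ->
  (forall x t, 0 <= t -> (0 < P t x setT)%E) ->
  0 < c0 -> 0 < t0 ->
  (forall x A, measurable A -> (c0%:E * nu A <= condK (P t0) x A)%E) ->
  (forall t, 0 <= t -> lsc_kernel (P t)) ->
  continuous psi -> bounded_fun psi -> (exists e : R, 0 < e /\ forall x, e <= psi x) ->
  0 < a ->
  submarkov_semigroup Pt ->
  (forall t, 0 <= t -> forall A B, measurable A -> measurable B ->
     (\int[Lam]_(x in A) ((psi x)%:E * P t x B) =
      (a `^ t)%:E * \int[Lam]_(y in B) ((psi y)%:E * Pt t y A))%E) ->
  (forall t, 0 <= t -> forall A, measurable A ->
     (\int[pit]_y Pt t y A = (\int[pit]_y Pt t y setT) * pit A)%E) ->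
  (exists g : T -> R, [/\ measurable_fun setT g, (forall x, 0 <= g x),
      bounded_fun g &
      forall A, measurable A -> pit A = (\int[Lam]_(x in A) (g x)%:E)%E]) ->
  open O -> 0 < c1 -> 0 < t1 ->
  (forall A, measurable A -> (c1%:E * Lam (A `&` O) <= pit A)%E) ->
  (0 < \int[nu]_x P t1 x O)%E ->
  let lam := a * fine (\int[pit]_y Pt 1%R y setT)%E in
  0 < lam /\
  (exists h : T -> R, [/\ measurable_fun setT h, bounded_fun h,
      (forall x, 0 < h x) &
      forall t x, 0 <= t -> kact (P t) h x = ((lam `^ t) * h x)%:E]) /\
  (forall V : set T, open V ->
     (forall t, 0 <= t -> forall f : T -> R,
        bnn_lsc_contV V f -> bnn_lsc_contV V (kactR (P t) f)) ->
     exists h : T -> R, [/\ measurable_fun setT h, bounded_fun h,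
      (forall x, 0 < h x),
      (forall t x, 0 <= t -> kact (P t) h x = ((lam `^ t) * h x)%:E) &
      (forall x, V x -> {for x, continuous h})]).

Proof.
move=> borelT sLam fullLam sgP _ P_gt0 c0_gt0 t0_gt0 minor lscP cpsi bpsi.
move=> [e [e_gt0 epsi]] a_gt0 sgPt dual qsd [g [mg g0 bg pitE]].
move=> oO c1_gt0 t1_gt0 pit_ge hitO lam.
have [b _ psib] := bounded_fun_norm_le bpsi.
have psi_eb x : e <= psi x <= b.
  by rewrite epsi/= (le_trans (ler_norm _)).
have [M M_gt0 gM] := bounded_fun_norm_le bg.
have pit_le A : measurable A -> (pit A <= M%:E * Lam A)%E.
  move=> mA; rewrite pitE// -integral_cst//; apply: ge0_le_integral => //.
  - by move=> x _; rewrite lee_fin.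
  - by apply/measurable_EFinP; exact: measurable_funTS.
  - by move=> x _; rewrite lee_fin (le_trans (ler_norm _)).
have [lam_gt0 [h [bh h_gt0 hE happ]]] :=
  exists_eigenfunction borelT sLam fullLam sgP P_gt0 c0_gt0 t0_gt0 minor lscP cpsi
    e_gt0 psi_eb a_gt0 sgPt dual qsd M_gt0 pit_le oO c1_gt0 t1_gt0 pit_ge hitO.
have hkact t x : 0 <= t -> kact (P t) h x = (lam `^ t * h x)%:E.
  by move=> t_ge0; rewrite /kact kint_EFin// hE.
split; first exact: lam_gt0.
have bfh := bmn_bounded bh; have [mh _] := bh.
split; first by exists h.
(* The same [h] serves for every [V]: the constant 1 belongs to the class preserved by [P_t], so
   each [P_t 1] is continuous on [V], and [h] is a uniform limit of multiples of these functions. *)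
move=> V _ PV; exists h; split => // x Vx.
apply: uniform_approx_continuous_at => eps /happ[t [t_ge0 ht]].
exists (fun y => (lam `^ t)^-1 * kint (P t) (cst 1) y); split => //.
have [|_ _ _ c1V] := PV t t_ge0 (cst 1).
  split => //; first exact: bmn_bounded (bmn_cst ler01).
    by move=> y z yz; exists setT => //; exact: filterT.
  by move=> y _; exact: cst_continuous.
by apply: cvgMl_tmp; exact: c1V.
Qed.
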